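(* Let $(G,\mathbf{c})$ be an edge-colored graph, $G=(V,E)$, $C=\mathbf{c}(E)$. If $(G,\mathbf{c})$ is minimally angle-rigid, then for each color $c_j\in C$ there exist a transversal $X\in T_{\mathbf{c},j}(G)$ and a minimally rigid graph $H=(V,E(H))$ such that $G=H+X$ (that is, $E=E(H)\cup X$) and $X\cap E(H)=\emptyset$.
   Context: Graphs are finite and simple. A realization of $G=(V,E)$ is an injective map $p:V\to\mathbb{R}^2$. An edge-colored graph $(G,\mathbf{c})$ is a graph with a map $\mathbf{c}$ assigning a color to every edge; $C=\mathbf{c}(E)$. An angle framework is a triple $(G,\mathbf{c},p)$ with $p$ a realization. Write $P_{vw}=p_v-p_w$. Two angle frameworks $(G,\mathbf{c},p)$ and $(G,\mathbf{c},q)$ are equivalent if for any two edges of the same color the angle between the two lines spanned by these edges is the same in $p$ and in $q$ (same absolute value of the cosine). They are similar if there are a linear isometry $T$ of $\mathbb{R}^2$, $z\in\mathbb{R}^2$, $\lambda>0$ with $q_v=\lambda T(p_v)+z$ for all $v\in V$. $(G,\mathbf{c},p)$ is locally angle-rigid if all angle frameworks $(G,\mathbf{c},q)$ equivalent to it with $q$ sufficiently close to $p$ are similar to it. The angle-rigidity matrix is the $|E|\times(2|V|+|C|)$ matrix $R(G,\mathbf{c},p)=[\,R(G,p)\;\;M(G,\mathbf{c},p)\,]$, where $R(G,p)$ is the standard 2-dimensional rigidity matrix (row $vw$ has $P_{vw}$ in the columns of $v$, $-P_{vw}$ in the columns of $w$, zeros elsewhere) and $M(G,\mathbf{c},p)$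 has entry $-P_{vw}\cdot P_{vw}$ in row $vw$ and column $\mathbf{c}(vw)$, and $0$ elsewhere. $(G,\mathbf{c},p)$ is independent if the rows of $R(G,\mathbf{c},p)$ are linearly independent. $(G,\mathbf{c})$ is minimally angle-rigid if there is a non-empty Zariski open set $S\subset\mathbb{R}^{2|V|}$ of realizations such that for every $p\in S$, $(G,\mathbf{c},p)$ is locally angle-rigid and independent. For a color $c_j$, $T_{\mathbf{c},j}(G)$ is the collection of transversals, i.e. sets $X\subseteq E$ of $|C|-1$ edges containing exactly one edge of each color $c_i\in C$ with $c_i\neq c_j$. A minimally rigid graph $H$ on $V$ is one whose edge set is a basis of the generic 2-dimensional rigidity matroid of the complete graph on $V$: $|E(H)|=2|V|-3$ and $|E'|\le 2|V(E')|-3$ for every non-empty $E'\subseteq E(H)$, where $V(E')$ is the set of vertices incident with $E'$. *)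

(* Defs.v *)
From HB Require Import structures.
From mathcomp Require Import all_boot all_order all_algebra.
From mathcomp Require Import mpoly reals.

Set Implicit Arguments.
Unset Strict Implicit.
Unset Printing Implicit Defensive.

Import Order.TTheory GRing.Theory Num.Theory.
Local Open Scope ring_scope.

Record sgraph (V : finType) := SGraph {
  edges : {set {set V}};
  edges_card2 : forall e, e \in edges -> #|e| = 2%N
}.

(* Colors of non-edges are never used. *)
Definition coloring (V K : finType) := {set V} -> K.

Definition colors (V K : finType) (G : sgraph V) (c : coloring V K) : {set K} :=
  c @: edges G.

Definition dotp (R : realType) (u v : 'rV[R]_2) : R := (u *m v^T) 0 0.

Definition enorm (R : realType) (u : 'rV[R]_2) : R := Num.sqrt (dotp u u).

(* Absolute value of the cosine of the angle between the lines R u and R v. *)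
Definition abs_cos (R : realType) (u v : 'rV[R]_2) : R :=
  `|dotp u v / (enorm u * enorm v)|.

Definition placement (R : realType) (V : finType) := V -> 'rV[R]_2.

Definition realization (R : realType) (V : finType) (p : placement R V) : Prop :=
  injective p.

Definition fw_equivalent (R : realType) (V K : finType) (G : sgraph V)
    (c : coloring V K) (p q : placement R V) : Prop :=
  forall v w x y : V,
    [set v; w] \in edges G -> [set x; y] \in edges G ->
    c [set v; w] = c [set x; y] ->
    abs_cos (p v - p w) (p x - p y) = abs_cos (q v - q w) (q x - q y).

Definition fw_similar (R : realType) (V : finType) (p q : placement R V) : Prop :=
  exists (T : {linear 'rV[R]_2 -> 'rV[R]_2}) (z : 'rV[R]_2) (lambda : R),
    [/\ forall u, enorm (T u) = enorm u,
        0 < lambda &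
        forall v, q v = lambda *: T (p v) + z].

Definition locally_angle_rigid (R : realType) (V K : finType) (G : sgraph V)
    (c : coloring V K) (p : placement R V) : Prop :=
  exists2 eps : R, 0 < eps &
    forall q : placement R V,
      realization q -> fw_equivalent G c p q ->
      (forall v, enorm (q v - p v) < eps) ->
      fw_similar p q.

(* The entry in the row of the edge e and the column of the i-th coordinate
   of x.  For an edge, [enum e] lists its two endpoints; swapping them leaves
   the entry unchanged. *)
Definition rigidity_entry (R : realType) (V : finType) (p : placement R V)
    (e : {set V}) (x : V) (i : 'I_2) : R :=
  if enum e is [:: v; w] then
    if x == v then (p v - p w) 0 i
    else if x == w then - (p v - p w) 0 i
    else 0
  else 0.

Definition color_entry (R : realType) (V K : finType) (c : coloring V K)
    (p : placement R V) (e : {set V}) (k : K) : R :=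
  if enum e is [:: v; w] then
    if c e == k then - dotp (p v - p w) (p v - p w) else 0
  else 0.

Definition rigidity_matrix (R : realType) (V : finType) (G : sgraph V)
    (p : placement R V) : 'M[R]_(#|edges G|, #|{: V * 'I_2}|) :=
  \matrix_(r, s) rigidity_entry p (enum_val r) (enum_val s).1 (enum_val s).2.

Definition color_matrix (R : realType) (V K : finType) (G : sgraph V)
    (c : coloring V K) (p : placement R V) : 'M[R]_(#|edges G|, #|colors G c|) :=
  \matrix_(r, s) color_entry c p (enum_val r) (enum_val s).

Definition angle_rigidity_matrix (R : realType) (V K : finType) (G : sgraph V)
    (c : coloring V K) (p : placement R V) :
    'M[R]_(#|edges G|, #|{: V * 'I_2}| + #|colors G c|) :=
  row_mx (rigidity_matrix G p) (color_matrix G c p).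

Definition fw_independent (R : realType) (V K : finType) (G : sgraph V)
    (c : coloring V K) (p : placement R V) : Prop :=
  row_free (angle_rigidity_matrix G c p).

Definition coords (R : realType) (V : finType) (p : placement R V)
    (k : 'I_#|{: V * 'I_2}|) : R :=
  p (enum_val k).1 0 (enum_val k).2.

(* S is the complement of the common zero set of the polynomials in F. *)
Definition zariski_open (R : realType) (V : finType)
    (S : placement R V -> Prop) : Prop :=
  exists F : {mpoly R[#|{: V * 'I_2}|]} -> Prop,
    forall p, S p <-> exists2 f, F f & f.@[coords p] != 0.

Definition minimally_angle_rigid (R : realType) (V K : finType) (G : sgraph V)
    (c : coloring V K) : Prop :=
  exists S : placement R V -> Prop,
    [/\ zariski_open S,
        exists p, S p,
        forall p, S p -> realization p &
        forall p, S p -> locally_angle_rigid G c p /\ fw_independent G c p].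

Definition color_transversals (V K : finType) (G : sgraph V)
    (c : coloring V K) (j : K) : {set {set {set V}}} :=
  [set X : {set {set V}} | [&& X \subset edges G,
     #|X| == #|colors G c|.-1 &
     [forall k in colors G c :\ j, #|[set e in X | c e == k]| == 1%N]]].

Definition minimally_rigid (V : finType) (H : sgraph V) : Prop :=
  (#|edges H| + 3 = 2 * #|V|)%N /\
  forall F : {set {set V}}, F \subset edges H -> F != set0 ->
    (#|F| + 3 <= 2 * #|cover F|)%N.

Arguments minimally_angle_rigid R {V K} G c.

(* Main.v *)
Require Import Defs.
From HB Require Import structures.
From mathcomp Require Import boolp classical_sets functions interval_inference.
From mathcomp Require Import reals topology normedtype sequences.
From mathcomp Require Import all_boot all_order all_algebra zify ring lra.

(** Everything happens at one realization [p] of the given open set, which is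
    both independent and locally angle-rigid.

    Let [J] be the quarter turn.  Writing a displaced framework as
    [q v = p v + J (u v)], the lines spanned by the edges of color [k] all turn
    by the same angle, of tangent [t k], as soon as for each edge [vw] of color
    [k], with [P = p v - p w] and [U = u v - u w],
    [U.P - t k * (P.P) = - t k * (U.(J P))].
    The linear part of this system in the unknowns [(u, t)] is exactly the
    angle-rigidity matrix, and its right-hand side is a product of two linear
    forms.  The system has a four-dimensional space of trivial infinitesimal
    solutions, coming from translations, rotations and dilations; it is cut off
    by requiring [u a = u b = 0] at the ends of some edge [ab].  If there were
    fewer equations, pins included, than unknowns, a fixed-point argument
    ([bilinear_system_small_solution]) would produce arbitrarily small nonzero
    solutions, that is, equivalent frameworks near [p] with [p a] and [p b]
    fixed.  A similarity fixing two points is the identity or a reflection, so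
    close to [p] these frameworks cannot be similar to [p]: contradiction.
    Hence [2 |V| + |C| <= |E| + 4] ([locally_rigid_edge_count]).

    The other half is linear algebra on row dependencies.  Since [(p, 1)] is in
    the kernel of the matrix, the column of the color [j] is a combination of
    the others and can be dropped without losing independence of the rows.  The
    remaining color columns are then removed one at a time: deleting a column
    creates at most one dependency, which is nonzero at some edge of that color,
    and deleting that edge destroys it ([extract_edge]).  The deleted edges form
    the transversal [X], and the rows of the ordinary rigidity matrix indexed by
    [E \ X] stay independent.  Any nonempty independent set [F] of
    rows satisfies [|F| <= 2 |V(F)| - 3], by pinning again
    ([color_independent_card]), and the count above gives
    [|E \ X| >= 2 |V| - 3]; so [E \ X] is minimally rigid. *)

Set Implicit Arguments.
Unset Strict Implicit.
Unset Printing Implicit Defensive.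

Import Order.TTheory GRing.Theory Num.Theory.
Import numFieldNormedType.Exports.
Local Open Scope ring_scope.

(** * Small solutions of underdetermined bilinear systems *)

(** This joins the complete and normed structures of matrices, so that the
    fixed-point theorem for contractions applies to row vectors. *)
HB.instance Definition _ (R : realType) (m n : nat) := Complete.on 'M[R]_(m, n).

Lemma norm_rV_le (R : realType) n (x : 'rV[R]_n) (r : R) :
  0 <= r -> (`|x| <= r) <-> (forall i, `|x 0 i| <= r).
Proof.
move=> r0; rewrite {1}/Num.norm /= mx_normrE; split=> [/bigmax_leP [_ h] i|h].
  exact: (h (0, i)).
by apply/bigmax_leP; split=> // -[i j] _ /=; rewrite (ord1 i).
Qed.

Lemma norm_coord_le (R : realType) n (x : 'rV[R]_n) i : `|x 0 i| <= `|x|.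
Proof. by move/(norm_rV_le x (normr_ge0 x)): (lexx `|x|). Qed.

Lemma mulmx_bounded (R : realType) m n (X : 'M[R]_(m, n)) :
  exists2 k : R, 0 <= k & forall z : 'rV_m, `|z *m X| <= k * `|z|.
Proof.
exists (\sum_i \sum_j `|X i j|) => [|z].
  by apply: sumr_ge0 => i _; exact: sumr_ge0.
apply/norm_rV_le => [|j]; first by rewrite mulr_ge0 // ?sumr_ge0 // => i _;
    exact: sumr_ge0.
rewrite mxE mulr_suml; apply: (le_trans (ler_norm_sum _ _ _)).
apply: ler_sum => i _; rewrite normrM mulrC ler_pM // ?norm_coord_le //.
by rewrite (bigD1 j) //= lerDl sumr_ge0.
Qed.

(** Let [h] be a nonzero vector of the kernel of [L], and [D] a right inverse of
    the map [z |-> z L].  Along [z = s h + y D] the equation reads [y = N z],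
    with [N] the quadratic right-hand side, and for small [s] the map
    [y |-> N (s h + y D)] contracts a small ball into itself.  Its fixed point
    gives a solution, nonzero because [z L = y]: if [z] vanished, so would [y],
    and then [s h]. *)
Lemma bilinear_system_small_solution (R : realType) m n (L A B : 'M[R]_(n, m))
    (eps : R) :
  row_full L -> (m < n)%N -> 0 < eps ->
  exists z : 'rV[R]_n, [/\ z != 0, `|z| < eps &
    forall j, (z *m L) 0 j = (z *m A) 0 j * (z *m B) 0 j].
Proof.
move=> Lfull mn eps0.
have [h h0 hL] : exists2 h : 'rV_n, h != 0 & h *m L = 0.
  exists (nz_row (kermx L)).
    rewrite nz_row_eq0 kermx_eq0 /row_free; apply: contraTneq (rank_leq_col L) => ->.
    by rewrite -ltnNge.
  by apply/eqP; rewrite -sub_kermx nz_row_sub.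
pose D := pinvmx L.
have DL : D *m L = 1%:M by exact: mulVpmx.
pose N (z : 'rV[R]_n) : 'rV[R]_m := \row_j ((z *m A) 0 j * (z *m B) 0 j).
have NE z j : N z 0 j = (z *m A) 0 j * (z *m B) 0 j by rewrite mxE.
have [M [M1 MA MB MD]] : exists M : R, [/\ 1 <= M,
    forall (z : 'rV_n) j, `|(z *m A) 0 j| <= M * `|z|,
    forall (z : 'rV_n) j, `|(z *m B) 0 j| <= M * `|z| &
    forall y : 'rV_m, `|y *m D| <= (M - 1) * `|y|].
  have [a a0 Ha] := mulmx_bounded A; have [b b0 Hb] := mulmx_bounded B.
  have [d d0 Hd] := mulmx_bounded D.
  exists (1 + (a + b + d)); split.
  - by rewrite lerDl !addr_ge0.
  - move=> z j; apply: (le_trans (norm_coord_le _ _)); apply: (le_trans (Ha z)).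
    by apply: ler_wpM2r => //; lra.
  - move=> z j; apply: (le_trans (norm_coord_le _ _)); apply: (le_trans (Hb z)).
    by apply: ler_wpM2r => //; lra.
  - move=> y; apply: (le_trans (Hd y)).
    by apply: ler_wpM2r => //; lra.
have M0 : 0 < M by lra.
(* On the ball of radius rho in y one has |z| <= M rho.  The first bound on rho
   makes N map this ball to itself with Lipschitz constant at most 1/2, the
   second one makes z smaller than eps. *)
pose rho := Num.min ((8%:R * M ^+ 4)^-1) (eps / (2%:R * M)).
have rho0 : 0 < rho.
  by rewrite lt_min invr_gt0 divr_gt0 ?mulr_gt0 ?exprn_gt0 ?ltr0n.
have rho1 : 8%:R * M ^+ 4 * rho <= 1.
  rewrite mulrC -ler_pdivlMr ?mulr_gt0 ?exprn_gt0 ?ltr0n //.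
  by rewrite div1r ge_min lexx.
have rho2 : M * rho < eps.
  suff : rho * (2%:R * M) <= eps by have := mulr_gt0 M0 rho0; lra.
  by rewrite -ler_pdivlMr ?mulr_gt0 ?ltr0n // ge_min lexx orbT.
pose s := rho / `|h|.
have nh : 0 < `|h| by rewrite normr_gt0.
have s0 : 0 < s by exact: divr_gt0.
pose a (y : 'rV[R]_m) : 'rV[R]_n := s *: h + y *m D.
have a_le y : `|y| <= rho -> `|a y| <= M * rho.
  move=> yr; apply: (le_trans (ler_normD _ _)).
  rewrite normrZ (gtr0_norm s0) /s divfK ?gt_eqF //.
  have := MD y; have : (M - 1) * `|y| <= (M - 1) * rho.
    by apply: ler_wpM2l => //; lra.
  by lra.
have aB y y' : a y - a y' = (y - y') *m D.
  by rewrite /a opprD addrACA subrr add0r mulmxBl.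
pose U : set 'rV[R]_m := closed_ball_ Num.norm 0 rho.
have UE y : U y <-> `|y| <= rho by rewrite /U /closed_ball_ /= sub0r normrN.
have NU : forall y, U y -> U (N (a y)).
  move=> y /UE yr; apply/UE/norm_rV_le => [|j]; first exact: ltW.
  rewrite NE normrM.
  have ar := a_le y yr.
  have h1 : `|(a y *m A) 0 j| <= M * (M * rho).
    by apply: (le_trans (MA _ _)); rewrite ler_pM2l.
  have h2 : `|(a y *m B) 0 j| <= M * (M * rho).
    by apply: (le_trans (MB _ _)); rewrite ler_pM2l.
  have h3 := ler_pM (normr_ge0 _) (normr_ge0 _) h1 h2.
  apply: (le_trans h3).
  have -> : M * (M * rho) * (M * (M * rho)) = (M ^+ 4 * rho) * rho by ring.
  rewrite -[leRHS]mul1r ler_pM2r //.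
  have : 0 < M ^+ 4 * rho by rewrite mulr_gt0 ?exprn_gt0.
  by lra.
have Nlip y y' : U y -> U y' -> `|N (a y) - N (a y')| <= 2%:R^-1 * `|y - y'|.
  move=> /UE yr /UE yr'; apply/norm_rV_le => [|j].
    by rewrite mulr_ge0 // invr_ge0 ler0n.
  rewrite mxE [X in _ + X]mxE !NE.
  set a1 := (a y *m A) 0 j; set b1 := (a y *m B) 0 j.
  set a2 := (a y' *m A) 0 j; set b2 := (a y' *m B) 0 j.
  have -> : a1 * b1 - a2 * b2 = a1 * (b1 - b2) + (a1 - a2) * b2 by ring.
  have hD : `|a y - a y'| <= M * `|y - y'|.
    by rewrite aB; apply: (le_trans (MD _)); apply: ler_wpM2r => //; lra.
  have h1 : `|a1| <= M * (M * rho).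
    by apply: (le_trans (MA _ _)); rewrite ler_pM2l // a_le.
  have h2 : `|b2| <= M * (M * rho).
    by apply: (le_trans (MB _ _)); rewrite ler_pM2l // a_le.
  have h3 : `|a1 - a2| <= M * (M * `|y - y'|).
    have -> : a1 - a2 = ((a y - a y') *m A) 0 j.
      by rewrite mulmxBl [RHS]mxE [X in _ = _ + X]mxE.
    by apply: (le_trans (MA _ _)); rewrite ler_pM2l.
  have h4 : `|b1 - b2| <= M * (M * `|y - y'|).
    have -> : b1 - b2 = ((a y - a y') *m B) 0 j.
      by rewrite mulmxBl [RHS]mxE [X in _ = _ + X]mxE.
    by apply: (le_trans (MB _ _)); rewrite ler_pM2l.
  apply: (le_trans (ler_normD _ _)); rewrite !normrM.
  have h5 := ler_pM (normr_ge0 _) (normr_ge0 _) h1 h4.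
  have h6 := ler_pM (normr_ge0 _) (normr_ge0 _) h3 h2.
  apply: (le_trans (lerD h5 h6)).
  have -> : M * (M * rho) * (M * (M * `|y - y'|)) + 
    M * (M * `|y - y'|) * (M * (M * rho)) = (2%:R * M ^+ 4 * rho) * `|y - y'|.
    by ring.
  apply: ler_wpM2r => //.
  have : 0 < M ^+ 4 * rho by rewrite mulr_gt0 ?exprn_gt0.
  by lra.
have [y Uy yE] : exists2 y, U y & y = N (a y).
  pose g : {fun U >-> U} := mkfun NU.
  have gE y : g y = N (a y) by [].
  have : is_contraction g.
    exists (2%:R^-1)%:nng; split => /=; first by lra.
    by move=> [y y'] [Uy Uy'] /=; exact: Nlip.
  move/banach_fixed_point; apply.
    exact: closed_closed_ball_.
  by exists 0; apply/UE; rewrite normr0 ltW.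
have aL : a y *m L = y.
  by rewrite mulmxDl -scalemxAl hL scaler0 add0r -mulmxA DL mulmx1.
exists (a y); split.
- apply/eqP => ay0; move: (aL); rewrite ay0 mul0mx => y0.
  move: ay0; rewrite /a -y0 mul0mx addr0 => /eqP.
  by rewrite scaler_eq0 (negPf h0) gt_eqF.
- by apply: le_lt_trans rho2; apply/a_le/UE.
- by move=> j; rewrite aL {1}yE NE.
Qed.

(** Independence is stated through dependencies [w] between rows indexed by
    arbitrary finite types, so that rows can be evaluated on well-chosen
    vectors without enumerating the index types. *)
Definition independent_rows (R : realType) (I J : finType) (L : J -> I -> R) :=
  forall w : J -> R,
    (forall i, \sum_j w j * L j i = 0) -> forall j, w j = 0.

Lemma independent_rows_free (R : realType) (I J : finType) (L : J -> I -> R) :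
  independent_rows L ->
  row_free (\matrix_(r < #|J|, s < #|I|) L (enum_val r) (enum_val s)).
Proof.
move=> Lind; apply: inj_row_free => v vL.
suff v0 j : v 0 (enum_rank j) = 0.
  by apply/rowP => r; rewrite mxE -[r]enum_valK v0.
move: j; apply: Lind => i; have /rowP/(_ (enum_rank i)) := vL.
rewrite !mxE => {}vL; rewrite -[RHS]vL [RHS](reindex (@enum_rank J)) /=; last first.
  by apply: onW_bij; exact: enum_rank_bij.
by apply: eq_bigr => j _; rewrite mxE !enum_rankK.
Qed.

Lemma independent_rows_card (R : realType) (I J : finType) (L : J -> I -> R) :
  independent_rows L -> (#|J| <= #|I|)%N.
Proof. by move/independent_rows_free/eqP => <-; exact: rank_leq_col. Qed.

Lemma quadratic_system_small_solution (R : realType) (I J : finType)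
    (L A B : J -> I -> R) (eps : R) :
  independent_rows L -> (#|J| < #|I|)%N -> 0 < eps ->
  exists z : I -> R, [/\ exists i, z i != 0, forall i, `|z i| < eps &
    forall j, \sum_i L j i * z i =
      (\sum_i A j i * z i) * (\sum_i B j i * z i)].
Proof.
move=> /independent_rows_free Lfree JI eps0.
pose mx (X : J -> I -> R) :=
  (\matrix_(r < #|J|, s < #|I|) X (enum_val r) (enum_val s))^T.
have Lfull : row_full (mx L) by rewrite /row_full mxrank_tr.
have [z [z0 zeps zL]] := bilinear_system_small_solution (mx A) (mx B) Lfull JI eps0.
have mxz X j : \sum_i X j i * z 0 (enum_rank i) = (z *m mx X) 0 (enum_rank j).
  rewrite mxE [RHS](reindex (@enum_rank I)) /=; last first.
    by apply: onW_bij; exact: enum_rank_bij.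
  by apply: eq_bigr => s _; rewrite !mxE !enum_rankK mulrC.
exists (fun i => z 0 (enum_rank i)); split.
- have /rV0Pn[s zs] := z0; exists (enum_val s); by rewrite enum_valK.
- by move=> i; apply: le_lt_trans zeps; exact: norm_coord_le.
- by move=> j; rewrite !mxz.
Qed.

Lemma positive_lower_bound (R : realType) (T : finType) (f : T -> R) :
  exists2 eta : R, 0 < eta & forall x, 0 < f x -> eta <= f x.
Proof.
exists (\big[Num.min/1]_(x | 0 < f x) f x).
  by elim/big_ind : _ => // a b a0 b0; rewrite lt_min a0.
move=> x fx; rewrite (bigD1 x) //= ge_min lexx //.
Qed.

(** * Plane geometry *)

Definition quarter_turn (R : realType) (u : 'rV[R]_2) : 'rV[R]_2 :=
  \row_i (if i == 0 then - u 0 1 else u 0 0).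

Lemma quarter_turn0 (R : realType) (u : 'rV[R]_2) : quarter_turn u 0 0 = - u 0 1.
Proof. by rewrite mxE. Qed.

Lemma quarter_turn1 (R : realType) (u : 'rV[R]_2) : quarter_turn u 0 1 = u 0 0.
Proof. by rewrite mxE. Qed.

Lemma sum_ord2 (R : realType) (F : 'I_2 -> R) : \sum_i F i = F 0 + F 1.
Proof.
rewrite !big_ord_recl big_ord0 addr0; congr (F _ + F _); exact: val_inj.
Qed.

Lemma dotpE (R : realType) (u v : 'rV[R]_2) :
  dotp u v = u 0 0 * v 0 0 + u 0 1 * v 0 1.
Proof. by rewrite /dotp mxE sum_ord2 !mxE. Qed.

Lemma rV2D (R : realType) (u v : 'rV[R]_2) i : (u + v) 0 i = u 0 i + v 0 i.
Proof. by rewrite mxE. Qed.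

Lemma rV2N (R : realType) (u : 'rV[R]_2) i : (- u) 0 i = - u 0 i.
Proof. by rewrite mxE. Qed.

Lemma rV2Z (R : realType) a (u : 'rV[R]_2) i : (a *: u) 0 i = a * u 0 i.
Proof. by rewrite mxE. Qed.

Definition planeE := (dotpE, rV2D, rV2N, rV2Z, quarter_turn0, quarter_turn1).

Lemma rV2P (R : realType) (u v : 'rV[R]_2) :
  u 0 0 = v 0 0 -> u 0 1 = v 0 1 -> u = v.
Proof.
move=> e0 e1; apply/rowP => i; case: i => [[|[|//]] h].
- by have -> : Ordinal h = 0 by exact: val_inj.
- by have -> : Ordinal h = 1 by exact: val_inj.
Qed.

Lemma dotpp_ge0 (R : realType) (u : 'rV[R]_2) : 0 <= dotp u u.
Proof. by rewrite planeE -!expr2 addr_ge0 ?sqr_ge0. Qed.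

Lemma dotpp_eq0 (R : realType) (u : 'rV[R]_2) : dotp u u = 0 -> u = 0.
Proof.
rewrite planeE -!expr2 => /eqP; rewrite paddr_eq0 ?sqr_ge0 // !sqrf_eq0.
by case/andP => /eqP u0 /eqP u1; apply: rV2P; rewrite ?u0 ?u1 mxE.
Qed.

Lemma dotpp_gt0 (R : realType) (u : 'rV[R]_2) : u != 0 -> 0 < dotp u u.
Proof.
by move=> u0; rewrite lt_def dotpp_ge0 andbT; apply: contra_neq u0; exact: dotpp_eq0.
Qed.

Lemma orthogonal_frame_eq0 (R : realType) (d u : 'rV[R]_2) :
  d != 0 -> dotp u d = 0 -> dotp u (quarter_turn d) = 0 -> u = 0.
Proof.
move=> /dotpp_gt0 d0 ud uJd; apply: dotpp_eq0; apply: (mulIf (lt0r_neq0 d0)).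
rewrite mul0r; suff -> : dotp u u * dotp d d =
   dotp u d ^+ 2 + dotp u (quarter_turn d) ^+ 2 by rewrite ud uJd expr0n addr0.
by rewrite !planeE; ring.
Qed.

Lemma abs_cosE (R : realType) (u v : 'rV[R]_2) :
  abs_cos u v = Num.sqrt (dotp u v ^+ 2 / (dotp u u * dotp v v)).
Proof.
rewrite /abs_cos -sqrtr_sqr expr_div_n /enorm -sqrtrM ?dotpp_ge0 //.
by rewrite sqr_sqrtr // mulr_ge0 ?dotpp_ge0.
Qed.

(** The right-hand vector below is [P] turned by the angle of tangent [t], up to
    length; the hypothesis says that [Q] is orthogonal to its quarter turn. *)
Lemma parallel_of_turned (R : realType) (t : R) (P Q : 'rV[R]_2) :
  P != 0 -> dotp Q (quarter_turn P) = t * dotp Q P ->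
  exists m, Q = m *: (P + t *: quarter_turn P).
Proof.
move=> P0 QP.
have P20 := dotpp_gt0 P0.
exists (dotp Q P / dotp P P); apply/eqP; rewrite -subr_eq0; apply/eqP.
apply: (orthogonal_frame_eq0 P0).
  have -> : forall s : R, dotp (Q - s *: (P + t *: quarter_turn P)) P =
    dotp Q P - s * dotp P P by move=> s; rewrite !planeE; ring.
  by rewrite divfK ?subrr // gt_eqF.
have -> : forall s : R, dotp (Q - s *: (P + t *: quarter_turn P)) (quarter_turn P)
   = dotp Q (quarter_turn P) - t * (s * dotp P P).
  by move=> s; rewrite !planeE; ring.
by rewrite divfK ?gt_eqF // QP subrr.
Qed.

Lemma abs_cos_turned (R : realType) (t m m' : R) (P P' : 'rV[R]_2) :
  P != 0 -> P' != 0 -> m != 0 -> m' != 0 ->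
  abs_cos (m *: (P + t *: quarter_turn P)) (m' *: (P' + t *: quarter_turn P')) =
  abs_cos P P'.
Proof.
move=> P0 P'0 m0 m'0; rewrite !abs_cosE; congr Num.sqrt.
have dE (a b : R) (X Y : 'rV[R]_2) :
  dotp (a *: (X + t *: quarter_turn X)) (b *: (Y + t *: quarter_turn Y)) =
  a * b * (1 + t ^+ 2) * dotp X Y by rewrite !planeE; ring.
rewrite !dE; field.
rewrite m0 m'0 !gt_eqF ?dotpp_gt0 //= ?andbT.
by have := sqr_ge0 t; lra.
Qed.

(** A point at the same distance from [0] and with the same component along [d]
    as [y] is [y] or its mirror image in the line spanned by [d]: [Y - y] is
    orthogonal to [d], and [|Y| = |y|] becomes a quadratic equation in the
    component of [Y - y] along the quarter turn of [d]. *)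
Lemma equal_or_mirror (R : realType) (d y Y : 'rV[R]_2) :
  dotp Y Y = dotp y y -> dotp Y d = dotp y d ->
  dotp (Y - y) d = 0 /\
    (dotp (Y - y) (quarter_turn d) = 0 \/
     dotp (Y - y) (quarter_turn d) = - 2%:R * dotp y (quarter_turn d)).
Proof.
move=> YY Yd.
have deld : dotp (Y - y) d = 0.
  by rewrite -[RHS](subrr (dotp y d)) -{1}Yd !planeE; ring.
split=> //.
have dely : 2%:R * dotp y (Y - y) + dotp (Y - y) (Y - y) = 0.
  by rewrite -[RHS](subrr (dotp y y)) -{1}YY !planeE; ring.
have : dotp (Y - y) (quarter_turn d) *
    (dotp (Y - y) (quarter_turn d) + 2%:R * dotp y (quarter_turn d)) = 0.
  have -> : dotp (Y - y) (quarter_turn d) *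
    (dotp (Y - y) (quarter_turn d) + 2%:R * dotp y (quarter_turn d)) =
    dotp d d * (2%:R * dotp y (Y - y) + dotp (Y - y) (Y - y)) -
    dotp (Y - y) d * (dotp (Y - y) d + 2%:R * dotp y d).
    by rewrite !planeE; ring.
  by rewrite dely deld; ring.
move/eqP; rewrite mulf_eq0 => /orP[/eqP|/eqP]; first by left.
by right; lra.
Qed.

(** Fixing two points forces the ratio to be [1] and the linear part to fix
    [d], so each point stays in place or is reflected in the line through the
    two fixed points.  In the second case its displacement depends on [p] only. *)
Lemma similarity_fixing_two_points (R : realType) (V : finType)
    (p q : placement R V) (a b : V) :
  fw_similar p q -> q a = p a -> q b = p b -> p a != p b ->
  let d := p b - p a in
  forall v, dotp (q v - p v) d = 0 /\
    (dotp (q v - p v) (quarter_turn d) = 0 \/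
     dotp (q v - p v) (quarter_turn d) =
       - 2%:R * dotp (p v - p a) (quarter_turn d)).
Proof.
move=> [T [z [l [Tiso l0 qE]]]] qa qb pab d v.
have TN u : dotp (T u) (T u) = dotp u u.
  by apply/eqP; rewrite -eqr_sqrt ?dotpp_ge0 //; apply/eqP/Tiso.
have d0 : d != 0 by rewrite subr_eq0 eq_sym.
have d20 := dotpp_gt0 d0.
have qT w : q w - q a = l *: T (p w - p a).
  by rewrite !qE linearB scalerBr opprD addrACA subrr addr0.
have Td : l *: T d = d by rewrite -qT qa qb.
have l1 : l = 1.
  have : l ^+ 2 * dotp d d = dotp d d.
    by rewrite -{1}TN -[in RHS]Td !planeE; ring.
  rewrite -[RHS]mul1r => /(mulIf (lt0r_neq0 d20)) /eqP.
  by rewrite -subr_eq0 subr_sqr_1 mulf_eq0 subr_eq0 => /orP[/eqP //|/eqP]; lra.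
rewrite l1 scale1r in Td; set y := p v - p a.
have -> : q v - p v = T y - y.
  by rewrite -[T y]scale1r -l1 -qT qa /y opprB addrA subrK.
have Tyd : dotp (T y) d = dotp y d.
  have := TN (y - d); rewrite linearB /= Td.
  have e (X Y : 'rV[R]_2) : dotp (X - Y) (X - Y) = dotp X X -
      2%:R * dotp X Y + dotp Y Y.
    by rewrite !planeE; ring.
  by rewrite (e (T y)) (e y) TN; lra.
exact: equal_or_mirror.
Qed.

(** * Dependencies between the rows of the angle-rigidity matrix *)

Lemma enum_edge (V : finType) (e : {set V}) :
  #|e| = 2%N -> exists v w, [/\ v != w, e = [set v; w] & enum e = [:: v; w]].
Proof.
rewrite cardE => e2; have := enum_uniq e.
have eE x : (x \in enum e) = (x \in e) by rewrite mem_enum.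
case: (enum e) e2 eE => [|v [|w [|]]] // _ eE; rewrite /= andbT inE => vw.
by exists v, w; split=> //; apply/setP => x; rewrite -eE !inE.
Qed.

(** The row of [e] in the rigidity matrix, applied to the velocity field [u];
    at [u = p] it is the squared length of the edge. *)
Definition edge_form (R : realType) (V : finType) (p u : placement R V)
    (e : {set V}) : R :=
  if enum e is [:: v; w] then dotp (p v - p w) (u v - u w) else 0.

Lemma edge_formE (R : realType) (V : finType) (p u : placement R V) (v w : V) :
  v != w -> edge_form p u [set v; w] = dotp (p v - p w) (u v - u w).
Proof.
move=> vw; have [|x [y [xy exy]]] := @enum_edge V [set v; w].
  by rewrite cards2 vw.
rewrite /edge_form => ->.
have : v \in [set x; y] by rewrite -exy !inE eqxx.
have : w \in [set x; y] by rewrite -exy !inE eqxx orbT.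
rewrite !inE => /orP[] /eqP wE /orP[] /eqP vE; rewrite wE vE // in vw *.
- by rewrite eqxx in vw.
- by rewrite !planeE; ring.
- by rewrite eqxx in vw.
Qed.

Lemma sum_rigidity_entry (R : realType) (V : finType) (p u : placement R V)
    (e : {set V}) :
  \sum_(s : V * 'I_2) rigidity_entry p e s.1 s.2 * u s.1 0 s.2 = edge_form p u e.
Proof.
rewrite -(pair_bigA _ (fun x i => rigidity_entry p e x i * u x 0 i)) /=.
rewrite /rigidity_entry /edge_form; have := enum_uniq e.
case: (enum e) => [|v [|w [|? ?]]]; try by
  move=> _; apply: big1 => x _; apply: big1 => i _; rewrite mul0r.
rewrite /= andbT inE => vw.
have wv : w != v by rewrite eq_sym.
rewrite (bigD1 v) //= (bigD1 w) //= [X in _ + (_ + X)]big1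
  => [|x /andP[xv xw]]; last first.
  by apply: big1 => i _; rewrite (negPf xv) (negPf xw) mul0r.
by rewrite !sum_ord2 !eqxx (negPf wv) !planeE; ring.
Qed.

Lemma color_entryE (R : realType) (V K : finType) (c : coloring V K)
    (p : placement R V) (e : {set V}) (k : K) :
  color_entry c p e k = if c e == k then - edge_form p p e else 0.
Proof.
rewrite /color_entry /edge_form; case: (enum e) => [|v [|w [|? ?]]] //;
by rewrite ?oppr0 if_same.
Qed.

Lemma edge_form_gt0 (R : realType) (V : finType) (p : placement R V)
    (e : {set V}) : realization p -> #|e| = 2%N -> 0 < edge_form p p e.
Proof.
move=> pinj /enum_edge[v [w [vw -> _]]]; rewrite edge_formE // dotpp_gt0 //.
by rewrite subr_eq0 (inj_eq pinj).
Qed.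

(** Linear independence of the rows indexed by [F] in the angle-rigidity matrix,
    keeping only the color columns in [D]. *)
Definition color_independent (R : realType) (V K : finType)
    (F : {set {set V}}) (D : {set K}) (c : coloring V K) (p : placement R V) :=
  forall w : {set V} -> R,
    (forall x i, \sum_(e in F) w e * rigidity_entry p e x i = 0) ->
    (forall k, k \in D ->
       \sum_(e in F | c e == k) w e * edge_form p p e = 0) ->
    forall e, e \in F -> w e = 0.

Lemma stress_edge_form (R : realType) (V : finType) (F : {set {set V}})
    (p u : placement R V) (w : {set V} -> R) :
  (forall x i, \sum_(e in F) w e * rigidity_entry p e x i = 0) ->
  \sum_(e in F) w e * edge_form p u e = 0.
Proof.
move=> w0; under eq_bigr => e _ do rewrite -sum_rigidity_entry mulr_sumr.
rewrite exchange_big big1 //= => s _.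
under eq_bigr => e _ do rewrite mulrA.
by rewrite -mulr_suml w0 mul0r.
Qed.

Lemma fw_independent_color (R : realType) (V K : finType) (G : sgraph V)
    (c : coloring V K) (p : placement R V) :
  fw_independent G c p -> color_independent (edges G) (colors G c) c p.
Proof.
move=> Mfree w w0 wD e eE.
pose v : 'rV[R]_#|edges G| := \row_r w (enum_val r).
suff /eqP : v == 0.
  by move/rowP/(_ (enum_rank_in eE e)); rewrite !mxE enum_rankK_in.
rewrite -(mulmx_free_eq0 _ Mfree) /angle_rigidity_matrix mul_mx_row.
have -> : v *m rigidity_matrix G p = 0.
  apply/rowP => s; rewrite !mxE.
  rewrite -[RHS](w0 (enum_val s).1 (enum_val s).2) [RHS]big_enum_val /=.
  by apply: eq_bigr => r _; rewrite !mxE.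
suff -> : v *m color_matrix G c p = 0 by rewrite row_mx0.
apply/rowP => s; rewrite !mxE -[RHS]oppr0
  -[X in _ = - X](wD (enum_val s) (enum_valP s)).
rewrite big_mkcondr [X in - X]big_enum_val /= -sumrN.
apply: eq_bigr => r _; rewrite !mxE color_entryE.
by case: ifP => _; rewrite ?oppr0 ?mulr0 // mulrN.
Qed.

(** Evaluating a dependency on [u = p] shows that its weighted sums of squared
    lengths over the color classes add up to [0]; so if all of them but one
    vanish, the last one vanishes too. *)
Lemma color_independent_drop (R : realType) (V K : finType)
    (F : {set {set V}}) (D : {set K}) (c : coloring V K) (p : placement R V)
    (j : K) :
  c @: F \subset D -> color_independent F D c p ->
  color_independent F (D :\ j) c p.
Proof.
move=> /subsetP FD Find w w0 wD; apply: Find => // k kD.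
have [kj|kj] := eqVneq k j; last by apply: wD; rewrite !inE kj.
have := stress_edge_form p w0.
rewrite (partition_big c (mem D)) => [|e eF]; last by apply: FD; exact: imset_f.
rewrite (bigD1 k) //= [X in _ + X]big1 ?addr0 // => i /andP[iD ik].
by apply: wD; rewrite !inE iD andbT -kj.
Qed.

(** If independence survives without the column [k], any edge of color [k] can
    be deleted.  Otherwise there is a dependency [w] that violates only the
    equation of [k], and it is unique up to scaling.  It is nonzero at some edge
    [e] of color [k]; a dependency avoiding [e] is a multiple of [w] that
    vanishes at [e], hence zero. *)
Lemma extract_edge (R : realType) (V K : finType)
    (F : {set {set V}}) (D : {set K}) (c : coloring V K) (p : placement R V)
    (k : K) :
  k \in D -> k \in c @: F -> color_independent F D c p ->
  exists e, [/\ e \in F, c e = k & color_independent (F :\ e) (D :\ k) c p].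
Proof.
move=> kD /imsetP[e1 e1F ke1] Find.
(* A dependency on F minus e extends by 0 at e. *)
have widen e : e \in F -> c e = k -> forall w : {set V} -> R,
    (forall x i, \sum_(f in F :\ e) w f * rigidity_entry p f x i = 0) ->
    (forall l, l \in D :\ k ->
       \sum_(f in F :\ e | c f == l) w f * edge_form p p f = 0) ->
    exists w' : {set V} -> R, [/\ w' e = 0, forall f, f \in F :\ e -> w' f = w f,
      forall x i, \sum_(f in F) w' f * rigidity_entry p f x i = 0 &
      forall l, l \in D :\ k ->
        \sum_(f in F | c f == l) w' f * edge_form p p f = 0].
  move=> eF ck w w0 wD; exists (fun f => if f == e then 0 else w f).
  rewrite eqxx; split=> //.
  - by move=> f; rewrite !inE => /andP[/negPf ->].
  - move=> x i; rewrite (big_setD1 e) //= eqxx mul0r add0r -[RHS](w0 x i).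
    by apply: eq_bigr => f; rewrite !inE => /andP[/negPf ->].
  - move=> l lD; rewrite -[RHS](wD l lD); apply: eq_big => f.
      rewrite !inE; have [->|//] := eqVneq f e.
      by move: lD; rewrite !inE ck [k == l]eq_sym => /andP[/negPf ->]; rewrite andbF.
    case/andP => fF /eqP cf; have [fe|//] := eqVneq f e.
    by move: lD; rewrite !inE -cf fe ck eqxx.
have [Find'|] := pselect (color_independent F (D :\ k) c p).
  exists e1; split=> // w w0 wD f fF.
  have [w' [_ w'w w'0 w'D]] := widen e1 e1F (esym ke1) w w0 wD.
  by rewrite -w'w //; apply: (Find' _ w'0 w'D); move: fF; rewrite !inE => /andP[].
move=> /existsNP[w /not_implyP[w0 /not_implyP[wD /existsNP[e0]]]].
move=> /not_implyP[e0F we0].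
pose b := \sum_(f in F | c f == k) w f * edge_form p p f.
have b0 : b != 0.
  apply/eqP => b0; apply: we0; apply: Find => // l lD.
  by have [->//|lk] := eqVneq l k; apply: wD; rewrite !inE lk.
have [e [eF ce we]] : exists e, [/\ e \in F, c e = k & w e != 0].
  apply: contrapT => no; move/eqP: b0; apply; apply: big1 => f /andP[fF /eqP cf].
  have [->|wf] := eqVneq (w f) 0; first by rewrite mul0r.
  by case: no; exists f.
exists e; split=> // v v0 vD f fF.
have [v' [v'e v'v v'0 v'D]] := widen e eF ce v v0 vD.
pose a := \sum_(f in F | c f == k) v' f * edge_form p p f.
have z : forall f, f \in F -> v' f - a / b * w f = 0.
  apply: Find => [x i|l lD].
    under eq_bigr => g _ do rewrite mulrBl -(mulrA (a / b)).
    by rewrite sumrB -mulr_sumr v'0 w0 mulr0 subrr.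
  under eq_bigr => g _ do rewrite mulrBl -(mulrA (a / b)).
  rewrite sumrB -mulr_sumr; have [->|lk] := eqVneq l k.
    by rewrite -/a -/b divfK // subrr.
  by rewrite v'D ?wD ?mulr0 ?subrr // !inE lk.
have ab : a / b = 0.
  have := z e eF; rewrite v'e sub0r => /eqP.
  by rewrite oppr_eq0 mulf_eq0 (negPf we) orbF => /eqP.
rewrite -v'v //; have := z f; rewrite ab mul0r subr0; apply.
by move: fF; rewrite !inE => /andP[].
Qed.

Lemma extract_transversal (R : realType) (V K : finType)
    (F : {set {set V}}) (D : {set K}) (c : coloring V K) (p : placement R V) :
  D \subset c @: F -> color_independent F D c p ->
  exists X : {set {set V}}, [/\ X \subset F, #|X| = #|D|,
    forall k, k \in D -> #|[set e in X | c e == k]| = 1%N,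
    {in X, forall e, c e \in D} &
    color_independent (F :\: X) set0 c p].
Proof.
move Dn : #|D| => n; elim: n F D Dn => [|n IHn] F D Dn DF Find.
  have D0 : D = set0 by apply/eqP; rewrite -cards_eq0 Dn.
  rewrite D0 in Find *; exists set0; rewrite sub0set cards0 setD0; split=> //.
  - by move=> k; rewrite inE.
  - by move=> e; rewrite inE.
have [k kD] : exists k, k \in D by apply/card_gt0P; rewrite Dn.
have [e [eF ce eind]] := extract_edge kD (subsetP DF _ kD) Find.
have [||X [XF Xn X1 XD Xind]] := IHn (F :\ e) (D :\ k) _ _ eind.
- by move: Dn; rewrite (cardsD1 k) kD => -[].
- apply/subsetP => l; rewrite !inE => /andP[lk lD].
  have /imsetP[f fF lf] := subsetP DF _ lD; apply/imsetP; exists f => //.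
  by rewrite !inE fF andbT; apply: contra_neq lk => fe; rewrite lf fe.
have eX : e \notin X by apply/negP => /(subsetP XF); rewrite !inE eqxx.
exists (e |: X); split.
- rewrite subUset sub1set eF; apply: (subset_trans XF); exact: subsetDl.
- by rewrite cardsU1 eX Xn.
- move=> l lD; have [->|lk] := eqVneq l k.
    rewrite (_ : [set f in e |: X | c f == k] = [set e]) ?cards1 //.
    apply/setP => f; rewrite !inE; have [->|fe] /= := eqVneq f e.
      by rewrite ce eqxx.
    by apply/negP => /andP[/XD]; rewrite !inE => /andP[/negPf ->].
  have lDk : l \in D :\ k by rewrite !inE lk.
  rewrite -(X1 l lDk); apply: eq_card => f; rewrite !inE.
  by have [->|//] := eqVneq f e; rewrite ce [k == l]eq_sym (negPf lk) !andbF.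
- by move=> f; rewrite !inE => /orP[/eqP -> | /XD]; rewrite ?ce // !inE => /andP[].
- by rewrite setUC -setDDl setDDl setUC -setDDl.
Qed.

(** * Pinning the trivial motions *)

(** The unknowns are the coordinates [(u, t)] of a velocity field and of turning
    rates of the colors.  To the rows of the edges in [F] are added those that
    set to zero the velocities of [a] and [b], the velocities of the vertices
    outside [W], and the rates of the colors outside [D]. *)
Definition pinned_system (R : realType) (V K : finType) (F : {set {set V}})
    (W : {set V}) (D : {set K}) (c : coloring V K) (p : placement R V) (a b : V)
    (j : ({e | e \in F} + ('I_2 + 'I_2)) +
         ({x | x \notin W} * 'I_2 + {k | k \notin D}))
    (i : V * 'I_2 + K) : R :=
  match j with
  | inl (inl e) =>
      match i with
      | inl s => rigidity_entry p (val e) s.1 s.2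
      | inr k => color_entry c p (val e) k
      end
  | inl (inr (inl l)) => (i == inl (a, l))%:R
  | inl (inr (inr l)) => (i == inl (b, l))%:R
  | inr (inl s) => (i == inl (val s.1, s.2))%:R
  | inr (inr k) => (i == inr (val k))%:R
  end.

Definition unknowns (R : realType) (V K : finType) (u : placement R V)
    (t : K -> R) (i : V * 'I_2 + K) : R :=
  match i with inl s => u s.1 0 s.2 | inr k => t k end.

Lemma sum_pin (R : realType) (I : finType) (i0 : I) (z : I -> R) :
  \sum_i (i == i0)%:R * z i = z i0.
Proof.
rewrite (bigD1 i0) //= eqxx mul1r big1 ?addr0 // => i /negPf ->.
by rewrite mul0r.
Qed.

Lemma sum_edge_row (R : realType) (V K : finType) (c : coloring V K)
    (p u : placement R V) (t : K -> R) (e : {set V}) :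
  \sum_(i : V * 'I_2 + K) (match i with
      | inl s => rigidity_entry p e s.1 s.2
      | inr k => color_entry c p e k
      end) * unknowns u t i = edge_form p u e - t (c e) * edge_form p p e.
Proof.
rewrite big_sumType /= sum_rigidity_entry; congr (_ + _).
rewrite mulrC -mulNr -[RHS](sum_pin (c e) (fun k => - edge_form p p e * t k)).
by apply: eq_bigr => k _; rewrite color_entryE eq_sym; case: eqP => _;
  rewrite ?mul0r ?mul1r.
Qed.

Lemma edge_form_eq0 (R : realType) (V : finType) (p u : placement R V)
    (e : {set V}) :
  (forall v w, v \in e -> w \in e -> dotp (p v - p w) (u v - u w) = 0) ->
  edge_form p u e = 0.
Proof.
rewrite /edge_form => h; have eE x : (x \in enum e) = (x \in e) by rewrite mem_enum.
case: (enum e) eE => [|v [|w [|? ?]]] //= eE.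
by apply: h; rewrite -eE !inE eqxx ?orbT.
Qed.

(** A dependency between the rows is evaluated on test vectors.  Each coordinate
    of a vertex outside [W], and each color outside [D], occurs in one row only.
    All rows of edges vanish on the translations, on the rotation field [J p],
    and on the dilation [(p, 1)]; this kills the coefficients at [a] and [b],
    because [p b - p a] and its quarter turn span the plane.  What is left is a
    dependency between the rows of [F]. *)
Lemma pinned_system_independent (R : realType) (V K : finType)
    (F : {set {set V}}) (W : {set V}) (D : {set K}) (c : coloring V K)
    (p : placement R V) (a b : V) :
  (forall e, e \in F -> e \subset W) -> c @: F \subset D ->
  a \in W -> b \in W -> p a != p b ->
  color_independent F D c p ->
  independent_rows (@pinned_system R V K F W D c p a b).
Proof.
move=> FW /subsetP FD aW bW pab Find w w0.
pose we (e : {set V}) := oapp (fun e => w (inl (inl e))) 0 (insub e).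
have weE (e : {e | e \in F}) : we (val e) = w (inl (inl e)) by rewrite /we valK.
have key u t : \sum_(e in F) we e * (edge_form p u e - t (c e) * edge_form p p e) +
    (\sum_l w (inl (inr (inl l))) * u a 0 l +
     \sum_l w (inl (inr (inr l))) * u b 0 l) +
    (\sum_s w (inr (inl s)) * u (val s.1) 0 s.2 +
     \sum_k w (inr (inr k)) * t (val k)) = 0.
  have : \sum_i (\sum_j w j * pinned_system c p a b j i) * unknowns u t i = 0.
    by rewrite big1 // => i _; rewrite w0 mul0r.
  under eq_bigr => i _ do rewrite mulr_suml.
  rewrite exchange_big /=.
  under eq_bigr => j _ do (under eq_bigr => i _ do rewrite -mulrA; rewrite -mulr_sumr).
  rewrite !big_sumType /= => h; rewrite -[RHS]h.
  rewrite [X in X + _ + _]big_sub; congr (_ + (_ + _) + (_ + _));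
    apply: eq_bigr => j _.
  - by rewrite weE sum_edge_row.
  - by rewrite sum_pin.
  - by rewrite sum_pin.
  - by rewrite sum_pin.
  - by rewrite sum_pin.
have zero_form e (v : 'rV[R]_2) : edge_form p (fun=> v) e = 0.
  apply: edge_form_eq0 => x y _ _; rewrite !planeE; ring.
have wk k : w (inr (inr k)) = 0.
  have := key (fun=> 0) (fun l => (l == val k)%:R).
  rewrite big1 => [|e eF]; last first.
    rewrite zero_form; have [ck|_] := eqVneq (c e) (val k);
      last by rewrite mul0r subrr mulr0.
    by have := valP k; rewrite /= -ck FD ?imset_f.
  rewrite [X in _ + (X + _) + _]big1 => [|? _]; last by rewrite mxE mulr0.
  rewrite [X in _ + (_ + X) + _]big1 => [|? _]; last by rewrite mxE mulr0.
  rewrite [X in _ + (X + _)]big1 => [|? _]; last by rewrite mxE mulr0.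
  rewrite !add0r => <-; rewrite -[LHS](sum_pin k (fun l => w (inr (inr l)))).
  by apply: eq_bigr => l _; rewrite mulrC (inj_eq val_inj).
have ws s : w (inr (inl s)) = 0.
  pose u (x : V) : 'rV[R]_2 := \row_l ((x, l) == (val s.1, s.2))%:R.
  have u0 x : x \in W -> u x = 0.
    move=> xW; apply/rowP => l; rewrite !mxE xpair_eqE.
    by have [xs|//] := eqVneq x (val s.1); have := valP s.1; rewrite /= -xs xW.
  have := key u (fun=> 0).
  rewrite big1 => [|e eF]; last first.
    rewrite mul0r subr0 edge_form_eq0 ?mulr0 // => x y xe ye.
    by rewrite !u0 ?(subsetP (FW e eF)) // !planeE !mxE; ring.
  rewrite !u0 // [X in _ + (X + _) + _]big1 => [|? _]; last by rewrite mxE mulr0.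
  rewrite [X in _ + (_ + X) + _]big1 => [|? _]; last by rewrite mxE mulr0.
  rewrite [X in _ + (_ + X)]big1 => [|? _]; last by rewrite mulr0.
  rewrite !add0r addr0 => <-; rewrite -[LHS](sum_pin s (fun l => w (inr (inl l)))).
  apply: eq_bigr => l _; rewrite mulrC mxE !xpair_eqE.
  by rewrite (inj_eq val_inj) -xpair_eqE -!surjective_pairing.
have {}key u t : \sum_(e in F) we e * (edge_form p u e - t (c e) * edge_form p p e) +
    (\sum_l w (inl (inr (inl l))) * u a 0 l +
     \sum_l w (inl (inr (inr l))) * u b 0 l) = 0.
  rewrite -[RHS](key u t) [X in _ = _ + (X + _)]big1 => [|s _];
    last by rewrite ws mul0r.
  by rewrite [X in _ = _ + (_ + X)]big1 => [|s _]; rewrite ?wk ?mul0r // !addr0.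
pose al : 'rV[R]_2 := \row_l w (inl (inr (inl l))).
pose be : 'rV[R]_2 := \row_l w (inl (inr (inr l))).
have {}key u t : \sum_(e in F) we e * (edge_form p u e - t (c e) * edge_form p p e) +
    (dotp al (u a) + dotp be (u b)) = 0.
  rewrite -[RHS](key u t); congr (_ + (_ + _));
  by rewrite /dotp mxE; apply: eq_bigr => l _; rewrite !mxE.
have triv u t : (forall e, e \in F -> edge_form p u e = t (c e) * edge_form p p e) ->
    dotp al (u a) + dotp be (u b) = 0.
  move=> ut; rewrite -[RHS](key u t) big1 ?add0r // => e eF.
  by rewrite ut // subrr mulr0.
have alC (v : 'rV[R]_2) : dotp al v + dotp be v = 0.
  by apply: (triv (fun=> v) (fun=> 0)) => e _; rewrite zero_form mul0r.
(* The dilation and the rotation fields test [be] against p b - p a and its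
   quarter turn. *)
have be0 : be = 0.
  apply: (@orthogonal_frame_eq0 _ (p b - p a)); first by rewrite subr_eq0 eq_sym.
    have := triv p (fun=> 1) (fun e _ => esym (mul1r _)); have := alC (p a).
    by rewrite !planeE; lra.
  have := triv (fun x => quarter_turn (p x)) (fun=> 0).
  have := alC (quarter_turn (p a)); rewrite !planeE => h1 h2.
  suff : al 0 0 * - p a 0 1 + al 0 1 * p a 0 0 +
    (be 0 0 * - p b 0 1 + be 0 1 * p b 0 0) = 0.
    by lra.
  apply: h2 => e _; rewrite mul0r; apply: edge_form_eq0 => x y _ _.
  by rewrite !planeE; ring.
have al0 : al = 0.
  by apply: dotpp_eq0; have := alC al; rewrite be0 !planeE !mxE; lra.
have we0 : forall e, e \in F -> we e = 0.
  apply: Find => [x i|k kD].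
    have := key (fun y => \row_l ((y, l) == (x, i))%:R) (fun=> 0).
    rewrite al0 be0 (_ : dotp 0 _ + dotp 0 _ = 0) ?addr0; last first.
      by rewrite !planeE !mxE; ring.
    move=> h; rewrite -[RHS]h; apply: eq_bigr => e _; congr (_ * _).
    rewrite mul0r subr0 -sum_rigidity_entry
      -[LHS](sum_pin (x, i) (fun s => rigidity_entry p e s.1 s.2)).
    by apply: eq_bigr => s _; rewrite mxE -surjective_pairing mulrC.
  have := key (fun=> 0) (fun l => (l == k)%:R).
  rewrite al0 be0 (_ : dotp 0 _ + dotp 0 _ = 0) ?addr0; last first.
    by rewrite !planeE !mxE; ring.
  move=> h; apply: oppr_inj; rewrite oppr0 -[RHS]h big_mkcondr -sumrN.
  apply: eq_bigr => e _; rewrite zero_form sub0r mulrN.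
  by case: eqP => _; rewrite ?mul1r ?mul0r ?mulr0.
move=> [[e|[l|l]]|[s|k]] //.
- by rewrite -weE; apply: we0; exact: valP.
- by have /rowP/(_ l) := al0; rewrite !mxE.
- by have /rowP/(_ l) := be0; rewrite !mxE.
Qed.

Lemma card_pinned_system (V K : finType) (F : {set {set V}}) (W : {set V})
    (D : {set K}) :
  #|{: ({e | e \in F} + ('I_2 + 'I_2)) +
       ({x | x \notin W} * 'I_2 + {k | k \notin D})}| =
  (#|F| + 4 + (2 * (#|V| - #|W|) + (#|K| - #|D|)))%N.
Proof.
rewrite !card_sum card_prod !card_sig !card_ord mulnC.
rewrite -(cardC (mem W)) addKn -(cardC (mem D)) addKn.
by congr (_ + _ + (2 * _ + _))%N; apply: eq_card => x; rewrite !inE.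
Qed.

Lemma color_independent_card (R : realType) (V K : finType)
    (F : {set {set V}}) (D : {set K}) (c : coloring V K) (p : placement R V) :
  realization p -> {in F, forall e : {set V}, #|e| = 2%N} -> F != set0 ->
  c @: F \subset D -> color_independent F D c p ->
  (#|F| + 4 <= 2 * #|cover F| + #|D|)%N.
Proof.
move=> pinj F2 /set0Pn[e eF] FD Find.
have [a [b [ab eE _]]] := enum_edge (F2 e eF).
have FW f : f \in F -> f \subset cover F by move=> fF; exact: bigcup_sup.
have aW : a \in cover F by apply: (subsetP (FW e eF)); rewrite eE !inE eqxx.
have bW : b \in cover F by apply: (subsetP (FW e eF)); rewrite eE !inE eqxx orbT.
have pab : p a != p b by rewrite (inj_eq pinj).
have := independent_rows_card (pinned_system_independent FW FD aW bW pab Find).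
rewrite card_pinned_system card_sum card_prod card_ord.
have := max_card (mem (cover F)); have := max_card (mem D); lia.
Qed.

(** * Local rigidity bounds the number of edges from below *)

Definition taxicab (R : realType) (u : 'rV[R]_2) : R := `|u 0 0| + `|u 0 1|.

Lemma taxicab_gt0 (R : realType) (u : 'rV[R]_2) : u != 0 -> 0 < taxicab u.
Proof.
move=> u0; rewrite lt_def addr_ge0 ?normr_ge0 // andbT; apply: contra_neq u0.
move=> /eqP; rewrite paddr_eq0 ?normr_ge0 // !normr_eq0 => /andP[/eqP u0 /eqP u1].
by apply: rV2P; rewrite ?u0 ?u1 mxE.
Qed.

Lemma enorm_le_taxicab (R : realType) (u : 'rV[R]_2) : enorm u <= taxicab u.
Proof.
have t0 : 0 <= taxicab u by rewrite addr_ge0.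
rewrite -(ger0_norm t0) -sqrtr_sqr ler_wsqrtr // planeE -!expr2 /taxicab.
rewrite -(real_normK (num_real (u 0 0))) -(real_normK (num_real (u 0 1))).
have := mulr_ge0 (normr_ge0 (u 0 0)) (normr_ge0 (u 0 1)).
rewrite sqrrD; lra.
Qed.

Lemma dotp_lt_taxicab (R : realType) (u d : 'rV[R]_2) (eta : R) :
  d != 0 -> `|u 0 0| < eta -> `|u 0 1| < eta -> `|dotp u d| < eta * taxicab d.
Proof.
move=> /taxicab_gt0 d0 u0 u1; rewrite planeE; apply: (le_lt_trans (ler_normD _ _)).
rewrite !normrM /taxicab mulrDr; rewrite /taxicab in d0.
have e0 : 0 < eta by apply: le_lt_trans u0.
have h0 := ler_wpM2r (normr_ge0 (d 0 0)) (ltW u0).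
have h1 := ler_wpM2r (normr_ge0 (d 0 1)) (ltW u1).
have [dz|dz] := eqVneq (d 0 0) 0.
  by apply: ler_ltD => //; rewrite ltr_pM2r // ; move: d0; rewrite dz normr0 add0r.
by apply: ltr_leD => //; rewrite ltr_pM2r // normr_gt0.
Qed.

(** With too few edges the pinned system has small nonzero solutions.  They give
    equivalent frameworks near [p] that agree with [p] at [a] and [b].  Local
    rigidity makes such a framework equal to [p] up to a reflection, which is
    too far from [p]; but [u = 0] forces [t = 0], as edges have positive
    length. *)
Lemma locally_rigid_edge_count (R : realType) (V K : finType) (G : sgraph V)
    (c : coloring V K) (p : placement R V) :
  realization p -> edges G != set0 ->
  color_independent (edges G) (colors G c) c p ->
  locally_angle_rigid G c p ->
  (2 * #|V| + #|colors G c| <= #|edges G| + 4)%N.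
Proof.
move=> pinj /set0Pn[e0 e0E] Eind [eps eps0 rigid].
have [a [b [ab e0ab _]]] := enum_edge (edges_card2 e0E).
have pab : p a != p b by rewrite (inj_eq pinj).
rewrite leqNgt; apply/negP => few.
pose d := p b - p a.
have d0 : d != 0 by rewrite subr_eq0 eq_sym.
have Lind := @pinned_system_independent R V K (edges G) setT (colors G c) c p a b
  (fun e _ => subsetT e) (subxx _) (in_setT a) (in_setT b) pab Eind.
(* Displacements below eta1 keep the points distinct; those below eta2 are
   smaller than the displacement of any vertex that the reflection in the line
   through p a and p b moves. *)
have [eta1 eta10 Heta1] := positive_lower_bound
  (fun vw : V * V => taxicab (p vw.1 - p vw.2) / 4%:R).
have [eta2 eta20 Heta2] := positive_lower_bound
  (fun v : V => 2%:R * `|dotp (p v - p a) (quarter_turn d)| / taxicab d).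
pose eta := Num.min (Num.min eta1 eta2) (eps / 2%:R).
have eta0 : 0 < eta by rewrite !lt_min eta10 eta20 divr_gt0.
(* The quadratic part of the row of e is the rate of the color of e times
   minus the row of e in the rigidity matrix of the turned framework. *)
pose A (j : ({e | e \in edges G} + ('I_2 + 'I_2)) +
    ({x | x \notin [set: V]} * 'I_2 + {k | k \notin colors G c}))
    (i : V * 'I_2 + K) : R :=
  match j, i with inl (inl e), inr k => (k == c (val e))%:R | _, _ => 0 end.
pose B (j : ({e | e \in edges G} + ('I_2 + 'I_2)) +
    ({x | x \notin [set: V]} * 'I_2 + {k | k \notin colors G c}))
    (i : V * 'I_2 + K) : R :=
  match j, i with
  | inl (inl e), inl s =>
      - rigidity_entry (fun x => quarter_turn (p x)) (val e) s.1 s.2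
  | _, _ => 0 end.
have [|z [[i0 zi0] zsmall zsol]] :=
    quadratic_system_small_solution A B Lind _ eta0.
  rewrite card_pinned_system card_sum card_prod card_ord cardsT subnn.
  by have := max_card (colors G c); lia.
pose u (x : V) : 'rV[R]_2 := \row_l z (inl (x, l)).
pose t (k : K) := z (inr k).
have zE i : z i = unknowns u t i by case: i => [[x l]|k] //=; rewrite mxE.
have usmall x l : `|u x 0 l| < eta by rewrite mxE.
have usol e : e \in edges G -> edge_form p u e - t (c e) * edge_form p p e =
    - t (c e) * edge_form (fun x => quarter_turn (p x)) u e.
  move=> eE; rewrite -(sum_edge_row c p u t e).
  have := zsol (inl (inl (exist _ e eE))); rewrite /= => h.
  under eq_bigr => i _ do rewrite -zE.
  rewrite [LHS]h !big_sumType /= big1 => [|s _]; last by rewrite mul0r.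
  rewrite [X in _ * (_ + X)]big1 => [|s _]; last by rewrite mul0r.
  rewrite add0r addr0 sum_pin mulNr -mulrN; congr (_ * _).
  rewrite -sum_rigidity_entry -sumrN; apply: eq_bigr => -[x l] _.
  by rewrite mulNr zE.
have zpin j i : (forall i', A j i' = 0) ->
    (forall i', pinned_system c p a b j i' = (i' == i)%:R) -> z i = 0.
  move=> A0 ji; have := zsol j; rewrite [X in _ = X * _]big1 => [|i' _].
    rewrite mul0r => h; rewrite -[RHS]h -[LHS](sum_pin i z).
    by apply: eq_bigr => i' _; rewrite ji.
  by rewrite A0 mul0r.
have ua : u a = 0 by apply/rowP => l; rewrite !mxE; exact: (zpin (inl (inr (inl l)))).
have ub : u b = 0 by apply/rowP => l; rewrite !mxE; exact: (zpin (inl (inr (inr l)))).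
have tN k : k \notin colors G c -> t k = 0.
  by move=> kC; exact: (zpin (inr (inr (exist _ k kC)))).
pose q : placement R V := fun x => p x + quarter_turn (u x).
have eta_le1 : eta <= eta1 by rewrite !ge_min lexx.
have eta_le2 : eta <= eta2 by rewrite !ge_min lexx orbT.
have eta_le : 2%:R * eta <= eps.
  have : eta <= eps / 2%:R by rewrite ge_min lexx orbT.
  by lra.
have qinj : realization q.
  move=> x y qxy; apply: contrapT => /eqP xy.
  have P0 : p x - p y != 0 by rewrite subr_eq0 (inj_eq pinj).
  have := Heta1 (x, y); rewrite /= divr_gt0 ?taxicab_gt0 // => /(_ isT) h.
  have PJ : p x - p y = quarter_turn (u y) - quarter_turn (u x).
    by apply/eqP; rewrite subr_eq addrAC -/(q x) eq_sym subr_eq addrC eq_sym; apply/eqP.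
  have : taxicab (p x - p y) < 4%:R * eta.
    rewrite PJ /taxicab !planeE.
    have n0 := ler_normB (- u y 0 1) (- u x 0 1).
    have n1 := ler_normB (u y 0 0) (u x 0 0).
    rewrite !normrN in n0.
    have := usmall x 0; have := usmall x 1; have := usmall y 0; have := usmall y 1.
    lra.
  by lra.
have qedge v w : [set v; w] \in edges G -> [/\ p v - p w != 0 & exists2 m : R, m != 0 &
    q v - q w = m *: ((p v - p w) + t (c [set v; w]) *: quarter_turn (p v - p w))].
  move=> vwE; have vw : v != w by have := edges_card2 vwE; rewrite cards2; case: eqP.
  have P0 : p v - p w != 0 by rewrite subr_eq0 (inj_eq pinj).
  split=> //; set s := t _.
  have [|m qm] := @parallel_of_turned R s (p v - p w) (q v - q w) P0.
    have := usol _ vwE; rewrite -/s !edge_formE // => h.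
    apply/eqP; rewrite -subr_eq0; apply/eqP; rewrite -[RHS](subrr (- s * dotp
     (quarter_turn (p v) - quarter_turn (p w)) (u v - u w))) -{1}h.
    by rewrite /q !planeE; ring.
  exists m => //; apply: contra_neq vw => m0; apply: qinj; apply/eqP.
  by rewrite -subr_eq0 qm m0 scale0r.
have pq : fw_equivalent G c p q.
  move=> v w x y /qedge[P0 [m m0 ->]] /qedge[P'0 [m' m'0 ->]] cc.
  by rewrite cc abs_cos_turned.
have near v : enorm (q v - p v) < eps.
  apply: le_lt_trans (enorm_le_taxicab _) _; rewrite /q /taxicab !planeE.
  rewrite addrAC subrr add0r addrAC subrr add0r normrN.
  have := usmall v 0; have := usmall v 1; lra.
have qa : q a = p a.
  by rewrite /q ua; apply: rV2P; rewrite !planeE !mxE ?oppr0 addr0.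
have qb : q b = p b.
  by rewrite /q ub; apply: rV2P; rewrite !planeE !mxE ?oppr0 addr0.
have u0 v : u v = 0.
  have [] := similarity_fixing_two_points (rigid q qinj pq near) qa qb pab v.
  rewrite /= -/d; have -> : q v - p v = quarter_turn (u v) by rewrite /q addrAC subrr add0r.
  move=> Jud Juu.
  have ud : dotp (u v) (quarter_turn d) = 0 by rewrite -[RHS]oppr0 -Jud !planeE; ring.
  have JJ : dotp (quarter_turn (u v)) (quarter_turn d) = dotp (u v) d.
    by rewrite !planeE; ring.
  rewrite JJ in Juu; apply: (orthogonal_frame_eq0 d0) => //.
  case: Juu => // Juu; have [y0|y0] := eqVneq (dotp (p v - p a) (quarter_turn d)) 0.
    by rewrite Juu y0 mulr0.
  have dt := taxicab_gt0 d0.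
  have : 0 < 2%:R * `|dotp (p v - p a) (quarter_turn d)| / taxicab d.
    by rewrite divr_gt0 // mulr_gt0 // normr_gt0.
  move/(Heta2 v); rewrite ler_pdivlMr // => h.
  have := dotp_lt_taxicab d0 (usmall v 0) (usmall v 1).
  rewrite Juu normrM normrN normr_nat => h'.
  by have := ler_wpM2r (ltW dt) eta_le2; lra.
have t0 k : t k = 0.
  have [/imsetP[e eE ->]|/tN //] := boolP (k \in colors G c).
  have form0 r : edge_form r u e = 0.
    by apply: edge_form_eq0 => x y _ _; rewrite !u0 !planeE !mxE; ring.
  have := usol e eE; rewrite !form0 sub0r mulr0 => /eqP.
  rewrite oppr_eq0 mulf_eq0 => /orP[/eqP //|].
  by rewrite gt_eqF // edge_form_gt0 // (edges_card2 eE).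
move/eqP: zi0; apply; rewrite zE; case: i0 => [[x l]|k] //=.
by rewrite u0 mxE.
Qed.

(** * Splitting off a transversal *)

Lemma color_independent_sub (R : realType) (V K K' : finType)
    (F F' : {set {set V}}) (D : {set K'}) (c : coloring V K)
    (c' : coloring V K') (p : placement R V) :
  F' \subset F -> color_independent F set0 c p -> color_independent F' D c' p.
Proof.
move=> /subsetP F'F Find w w0 _ e eF'.
suff : (if e \in F' then w e else 0) = 0 by rewrite eF'.
have eF := F'F e eF'; clear eF'; move: e eF; apply: Find => [x i|k]; last by rewrite inE.
rewrite -[RHS](w0 x i) (bigID (mem F')) /= [X in _ + X]big1 ?addr0; last first.
  by move=> e /andP[_ /negPf ->]; rewrite mul0r.
apply: eq_big => [e|e /andP[_ ->] //].
by have [/F'F ->|] := boolP (e \in F'); rewrite ?andbF ?andbT.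
Qed.

(** The sparsity count for [F] comes from giving all its edges one common color:
    the fourth trivial motion is then paid for by the color column. *)
Lemma minimally_rigid_of_independent (R : realType) (V K : finType)
    (H : sgraph V) (c : coloring V K) (p : placement R V) :
  realization p -> color_independent (edges H) set0 c p ->
  (1 < #|V|)%N -> (2 * #|V| <= #|edges H| + 3)%N -> minimally_rigid H.
Proof.
move=> pinj Hind V2 Hn.
have sparse (F : {set {set V}}) : F \subset edges H -> F != set0 ->
    (#|F| + 3 <= 2 * #|cover F|)%N.
  move=> FH F0.
  have := @color_independent_card R V unit F setT (fun=> tt) p pinj _ F0
    (subsetT _) (color_independent_sub FH Hind).
  rewrite cardsT card_unit => /(_ (fun e eF => edges_card2 (subsetP FH e eF))).
  by rewrite !addnS !addn0 ltnS.
split=> //; apply/eqP; rewrite eqn_leq Hn andbT.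
have [->|H0] := eqVneq (edges H) set0; first by rewrite cards0; lia.
by apply: leq_trans (sparse _ (subxx _) H0) _; rewrite leq_mul2l max_card orbT.
Qed.

Theorem theorem3p5 (R : realType) (V K : finType) (G : sgraph V)
    (c : coloring V K) :
  minimally_angle_rigid R G c ->
  forall j : K, j \in colors G c ->
  exists (X : {set {set V}}) (H : sgraph V),
    [/\ X \in color_transversals G c j,
        minimally_rigid H,
        edges G = edges H :|: X &
        [disjoint X & edges H]].
Proof.
move=> [S [_ [p Sp] Sinj Srig]] j jC.
have pinj := Sinj p Sp; have [rigid /fw_independent_color Eind] := Srig p Sp.
have [e0 e0E _] := imsetP jC.
have E0 : edges G != set0 by apply/set0Pn; exists e0.
have count := locally_rigid_edge_count pinj E0 Eind rigid.
have [X [XE Xn X1 _ Hind]] := extract_transversal (subsetDl _ [set j])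
  (color_independent_drop (j := j) (subxx _) Eind).
have Hcard2 e : e \in edges G :\: X -> #|e| = 2%N.
  by rewrite inE => /andP[_ /edges_card2].
have C1 := cardsD1 j (colors G c); rewrite jC -Xn in C1.
have Hn := cardsID X (edges G); rewrite (setIidPr XE) in Hn.
have V2 : (1 < #|V|)%N by rewrite -(edges_card2 e0E) max_card.
exists X, (SGraph Hcard2); split.
- rewrite inE XE C1 eqxx /=; apply/forallP => k; apply/implyP => kD.
  by apply/eqP/X1.
- apply: (@minimally_rigid_of_independent R V K _ c p) => //=.
  by move: count; rewrite C1 -Hn; set x := #|X|; set h := #|_|; set v := #|V|; lia.
- by rewrite /= -[in LHS](setID (edges G) X) (setIidPr XE) setUC.
- by rewrite disjoint_sym /= disjoints_subset setDE subsetIr.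
Qed.
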